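(* Let $r,s$ be positive integers with $s\le r\le n-1$, let $P=P(m_1,\dots,m_{n-1})$ be a natural unit interval order with $m_1=\cdots=m_s=r$ and $m_{s+1}=\cdots=m_{n-1}=n$, and let $G=\mathrm{inc}(P)$. Then $$X_G(\mathbf{x},t)=\sum_{\ell=0}^{\min\{n-r,s\}}t^{(r-s)\ell}\,\frac{[n-r]_t!\,[s]_t!\,[r-\ell-1]_t!\,[n-s-\ell-1]_t!\,[n-2\ell]_t}{[n-r-\ell]_t!\,[s-\ell]_t!\,[r-s-1]_t!}\,e_{(n-\ell,\ell)}.$$ Consequently $X_G(\mathbf{x},t)$ is $e$-positive and $e$-unimodal with center of symmetry $\frac{\binom{n}{2}-(n-r)s}{2}$.
   Context: A natural unit interval order $P(m_1,\dots,m_{n-1})$ is defined for integers $m_1\le\cdots\le m_{n-1}\le n$ with $m_i\ge i$: it is the poset on $[n]$ with $i<_P j$ iff $i<n$ and $j\in\{m_i+1,\dots,n\}$. Its incomparability graph has vertex set $[n]$ and an edge $\{i,j\}$ ($i<j$) iff $j\le m_i$. The chromatic quasisymmetric function of a graph $G$ on $V\subset\mathbb{P}$ is $X_G(\mathbf{x},t)=\sum_\kappa t^{\mathrm{asc}(\kappa)}\prod_v x_{\kappa(v)}$ over proper colorings $\kappa:V\to\mathbb{P}$, with $\mathrm{asc}(\kappa)$ the number of edges $\{i,j\}$, $i<j$, with $\kappa(i)<\kappa(j)$. $[m]_t=1+t+\cdots+t^{m-1}$, $[m]_t!=[1]_t[2]_t\cdots[m]_t$, $[0]_t!=1$; $e_{(n,0)}=e_n$.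 Writing $X_G(\mathbf{x},t)=\sum_{i=0}^m a_i(\mathbf{x})t^i$ with symmetric functions $a_i$, $X_G$ is $e$-positive if each $a_i$ is a nonnegative combination of elementary symmetric functions $e_\lambda$, and $e$-unimodal with center of symmetry $c$ if it is palindromic about $c$ (i.e. $a_i=a_{2c-i}$) and $a_{i+1}-a_i$ is $e$-positive for $0\le i<c$ (equivalently here, every coefficient $C_\lambda(t)$ of $e_\lambda$ is a unimodal polynomial with nonnegative coefficients, palindromic with center $c$).
   Formalization: The explicit formula is stated only for s < r, because for r = s it contains the undefined factorial [r-s-1]_t! = [-1]_t!; e-positivity and e-unimodality are stated for all s ≤ r. *)

(* Defs.v *)
From HB Require Import structures.
From mathcomp Require Import all_boot all_order all_algebra.
From mathcomp Require Import mpoly.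
Set Implicit Arguments.
Unset Strict Implicit.
Unset Printing Implicit Defensive.
Import Order.TTheory GRing.Theory Num.Theory.
Local Open Scope ring_scope.

Definition nuio_lt (n : nat) (m : nat -> nat) (i j : nat) : bool :=
  [&& (i < n)%N, (m i < j)%N & (j <= n)%N].

(* incomparability graph inc(P); vertex v : 'I_n stands for the label v+1 *)
Definition inc_adj (n : nat) (m : nat -> nat) (u v : 'I_n) : bool :=
  [&& u != v, ~~ nuio_lt n m u.+1 v.+1 & ~~ nuio_lt n m v.+1 u.+1].

(* A graph on 'I_n (vertices ordered as integers) is given by a symmetric
   adjacency relation adj; edges are the pairs {u,v} with u < v, adj u v.
   Colours 1,2,... are represented by 'I_N (colour c+1 <-> variable x_{c+1}),
   coefficients live in {poly int} (the variable t is 'X). *)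
Definition proper_col (n N : nat) (adj : rel 'I_n) (k : {ffun 'I_n -> 'I_N}) : bool :=
  [forall u : 'I_n, forall v : 'I_n, ((u < v)%N && adj u v) ==> (k u != k v)].

Definition asc (n N : nat) (adj : rel 'I_n) (k : {ffun 'I_n -> 'I_N}) : nat :=
  #|[set p : 'I_n * 'I_n | [&& (p.1 < p.2)%N, adj p.1 p.2 & (k p.1 < k p.2)%N]]|.

Definition chromQ (n : nat) (adj : rel 'I_n) (N : nat) : {mpoly {poly int}[N]} :=
  \sum_(k : {ffun 'I_n -> 'I_N} | proper_col adj k)
     ('X^(asc adj k) *: \prod_(v : 'I_n) 'X_(k v)).

Definition e_part (N : nat) (la : seq nat) : {mpoly {poly int}[N]} :=
  \prod_(k <- la) mesym N {poly int} k.

Definition is_partition (n : nat) (la : seq nat) : bool :=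
  [&& sorted geq la, all (fun x => 0 < x)%N la & sumn la == n].

Definition qint (m : nat) : {poly int} := \sum_(i < m) 'X^i.
Definition qfact (m : nat) : {poly int} := \prod_(1 <= i < m.+1) qint i.

Definition nonneg_coefs (p : {poly int}) : Prop := forall i, 0 <= p`_i.

(* palindromic with center of symmetry D/2 : a_i = a_{D-i}, a_i = 0 for i > D *)
Definition palindromic2 (D : nat) (p : {poly int}) : Prop :=
  forall i, p`_i = if (i <= D)%N then p`_(D - i) else 0.

Definition incr_to_center2 (D : nat) (p : {poly int}) : Prop :=
  forall i, (2 * i < D)%N -> p`_i <= p`_i.+1.

(* X (given by its restrictions to N variables, for every N) expands in the
   e-basis over the finite list L of distinct partitions of n, with
   coefficients c la in Z[t]. *)
Definition e_expansion (n : nat) (X : forall N, {mpoly {poly int}[N]})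
    (L : seq (seq nat)) (c : seq nat -> {poly int}) : Prop :=
  [/\ uniq L, all (is_partition n) L &
      forall N, X N = \sum_(la <- L) c la *: e_part N la].

Definition e_positive (n : nat) (X : forall N, {mpoly {poly int}[N]}) : Prop :=
  exists L c, e_expansion n X L c /\ forall la, la \in L -> nonneg_coefs (c la).

Definition e_unimodal2 (n : nat) (X : forall N, {mpoly {poly int}[N]}) (D : nat) : Prop :=
  exists L c, e_expansion n X L c /\
    forall la, la \in L ->
      [/\ nonneg_coefs (c la), palindromic2 D (c la) & incr_to_center2 D (c la)].

(* Main.v *)
Require Import Defs.
From HB Require Import structures.
From mathcomp Require Import all_boot all_order all_algebra.
From mathcomp Require Import mpoly.
From mathcomp Require Import zify ring.
Import Order.TTheory GRing.Theory Num.Theory.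
Local Open Scope ring_scope.

(* Let A = {1..s}, B = {s+1..r}, C = {r+1..n}, of sizes a, b, c: the graph is
   the complete graph on A + B + C without the edges between A and C, so a
   colour class is empty, a single vertex, or one vertex of A with one of C.
   Peeling off the largest colour N therefore gives, with x = x_N,

     X(a,b,c) = X'(a,b,c)
       + x ([a] X'(a-1,b,c) + t^a [b] X'(a,b-1,c) + t^b [c] X'(a,b,c-1))
       + x^2 t^b [a] [c] X'(a-1,b,c-1)

   where X' uses the colours below N and [k] is the sum of t^rank over the
   possible vertices. Since e_k = e'_k + x e'_(k-1), the claimed sum over l of
   c_l(a,b,c) e_(n-l) e_l satisfies the same recursion as soon as

     c_l(a,b,c) + c_(l+1)(a,b,c)
       = [a] c_l(a-1,b,c) + t^b [c] c_l(a,b,c-1) + t^a [b] c_l(a,b-1,c),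

   which after clearing common factors is a polynomial identity in t and the
   three q-integers [a], [b], [c]. Each c_l is a power of t times a product of
   q-integers, and multiplying by a q-integer preserves being nonnegative,
   palindromic and unimodal. *)

Local Notation t := ('X : {poly int}).

(** * q-integers and the coefficients of the e-expansion *)

Lemma qint0 : qint 0 = 0.
Proof. by rewrite /qint big_ord0. Qed.

Lemma qintS m : qint m.+1 = qint m + t ^+ m.
Proof. by rewrite /qint big_ord_recr. Qed.

Lemma qint1 : qint 1 = 1.
Proof. by rewrite qintS qint0 add0r expr0. Qed.

(** Makes [ring] applicable: once every power of [t] is traded for a q-integer, the identities below
    are polynomial in [t] and a few independent q-integers. *)
Lemma expX_qint m : t ^+ m = 1 + (t - 1) * qint m.
Proof.
elim: m => [|m IHm]; first by rewrite qint0 expr0; ring.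
by rewrite qintS exprS IHm; ring.
Qed.

Lemma qintD m k : qint (m + k) = qint m + t ^+ m * qint k.
Proof.
elim: k => [|k IHk]; first by rewrite addn0 qint0; ring.
by rewrite addnS !qintS IHk exprD; ring.
Qed.

Lemma qfact0 : qfact 0 = 1.
Proof. by rewrite /qfact big_geq. Qed.

Lemma qfactS m : qfact m.+1 = qfact m * qint m.+1.
Proof. by rewrite /qfact big_nat_recr. Qed.

(* [qrise p l] is [p + l]_t! / [p]_t!. *)
Definition qrise (p l : nat) : {poly int} := \prod_(i < l) qint (p + i).+1.

Lemma qrise0 p : qrise p 0 = 1.
Proof. by rewrite /qrise big_ord0. Qed.

Lemma qriseS p l : qrise p l.+1 = qrise p l * qint (p + l).+1.
Proof. by rewrite /qrise big_ord_recr. Qed.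

Lemma qrise_recl p l : qrise p l.+1 = qint p.+1 * qrise p.+1 l.
Proof.
rewrite /qrise big_ord_recl /= addn0; congr (_ * _).
by apply: eq_bigr => i _; rewrite /= /bump /= addnA addn1.
Qed.

Lemma qfact_rise p l : qfact (p + l) = qfact p * qrise p l.
Proof.
elim: l => [|l IHl]; first by rewrite addn0 qrise0 mulr1.
by rewrite addnS qfactS IHl qriseS mulrA.
Qed.

Lemma qrise0l k : qrise 0 k = qfact k.
Proof. by rewrite -[k in RHS]add0n qfact_rise qfact0 mul1r. Qed.

(** The coefficient at [l = 0], with [p] and [q] standing for [a - l] and [c - l]. For [b = 0] the
    graph is two disjoint cliques, whose only term is [e_a e_c]; so [l] is the minimum of [a] and
    [c], and [p] or [q] is 0. *)
Definition ecore (p b q : nat) : {poly int} :=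
  if b is b'.+1 then qrise b' p * qfact (b' + q) * qint (p + q + b)
  else if (p == 0%N) || (q == 0%N) then qfact p * qfact q else 0.

(* The coefficient of [e_(a+b+c-l) e_l], with the quotient of q-factorials
   expanded into a product of q-integers. At [b = 0] the quotient would involve
   [-1]_t!; the value of [ecore] there is the one that makes [ecoef_rec] hold. *)
Definition ecoef (b a c l : nat) : {poly int} :=
  if (l <= a)%N && (l <= c)%N then
    t ^+ (b * l) * qrise (a - l) l * qrise (c - l) l * ecore (a - l) b (c - l)
  else 0.

(** This is [ecoef_rec] with its common factors removed, for [p] and [q] positive. The next three
    lemmas are the boundary cases, where the terms that would need [p - 1] or [q - 1] drop out. *)
Lemma ecore_rec p b q :
  ecore p.+1 b.+1 q.+1 + t ^+ b.+1 * qint p.+1 * qint q.+1 * ecore p b.+1 q =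
  qint p.+1 * ecore p b.+1 q.+1 + t ^+ b.+1 * qint q.+1 * ecore p.+1 b.+1 q
  + t ^+ p.+1 * qint b.+1 * ecore p.+1 b q.+1.
Proof.
case: b => [|b] /=.
  rewrite !qrise0l !add0n !qfactS !expX_qint mulr0 addr0.
  rewrite !(addnS, addSn, addn0).
  rewrite !(qintS, exprS) !(qintD, exprD) !expX_qint ?qint0; ring.
rewrite !(addnS, addSn) !qfactS (qrise_recl b) !qriseS ?(addnS, addSn).
rewrite !(qintS, exprS) !(qintD, exprD) !expX_qint; ring.
Qed.

Lemma ecore_rec_l0 b q :
  ecore 0 b.+1 q.+1 = t ^+ b.+1 * qint q.+1 * ecore 0 b.+1 q + qint b.+1 * ecore 0 b q.+1.
Proof.
case: b => [|b] /=.
  rewrite !add0n qrise0 qfact0 qint1 !addn1 !qfactS !(qintS, exprS) !expX_qint ?qint0; ring.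
rewrite !qrise0 !(addnS, addSn, add0n) !qfactS.
rewrite !(qintS, exprS) !(qintD, exprD) !expX_qint; ring.
Qed.

Lemma ecore_rec_r0 p b :
  ecore p.+1 b.+1 0 = qint p.+1 * ecore p b.+1 0 + t ^+ p.+1 * qint b.+1 * ecore p.+1 b 0.
Proof.
case: b => [|b] /=.
  rewrite !qrise0l !addn0 !addn1 !qfactS qfact0 qint1 !(qintS, exprS) !expX_qint ?qint0; ring.
rewrite !(addn0, addnS, addSn) !qfactS (qrise_recl b) !qriseS ?(addnS, addSn).
rewrite !(qintS, exprS) !(qintD, exprD) !expX_qint; ring.
Qed.

Lemma ecore_rec_00 b : ecore 0 b.+1 0 = qint b.+1 * ecore 0 b 0.
Proof.
case: b => [|b] /=; rewrite ?(add0n, addn0) !qrise0 ?qfactS ?qfact0; ring.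
Qed.

(** The differences [a - l] and [c - l] do not change, so [ecore] is the same and each [qrise] only
    gains its top factor. *)
Lemma ecoefS b a c l :
  ecoef b a.+1 c.+1 l.+1 = t ^+ b * qint a.+1 * qint c.+1 * ecoef b a c l.
Proof.
rewrite /ecoef !ltnS !subSS; case: ifP => [/andP[la lc]|_]; last by rewrite mulr0.
by rewrite !qriseS !subnK // mulnS exprD; ring.
Qed.

(** Both sides are [qrise p l.+1], with its top or its bottom factor split off. This trades [[a]]
    for [[a - l]] in [ecoef_rec]. *)
Lemma qrise_shift p l : qint (p.+1 + l) * qrise p l = qint p.+1 * qrise p.+1 l.
Proof. by rewrite -qrise_recl qriseS addSn mulrC. Qed.

Lemma ecoefE b p q l :
  ecoef b (p + l) (q + l) l =
  t ^+ (b * l) * qrise p l * qrise q l * ecore p b q.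
Proof. by rewrite /ecoef !leq_addl !addnK. Qed.

Lemma ecoef_out b a c l : (minn a c < l)%N -> ecoef b a c l = 0.
Proof. by rewrite /ecoef; case: ifP => //; lia. Qed.

Lemma ecoef_rec b a c l :
  ecoef b.+1 a c l + ecoef b.+1 a c l.+1 =
  qint a * ecoef b.+1 a.-1 c l + t ^+ b.+1 * qint c * ecoef b.+1 a c.-1 l
  + t ^+ a * qint b.+1 * ecoef b a c l.
Proof.
have [lac|lac] := ltnP (minn a c) l.
  rewrite !ecoef_out ?(ltnW lac) //; try lia; ring.
have [la lc] : (l <= a)%N /\ (l <= c)%N by lia.
rewrite -(subnK la) -(subnK lc).
move: (a - l)%N (c - l)%N => {a c la lc lac} p q.
(* At [a = l] the lowered coefficient is out of range; only [l = 0] escapes, since [0.-1 = 0], and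
   there the factor [[0]] vanishes. [predr] is the same for [c]. *)
have predl c : qint (0 + l) * ecoef b.+1 (0 + l).-1 c l = 0.
  by case: l => [|l]; rewrite ?qint0 ?mul0r // ecoef_out ?mulr0 //; lia.
have predr a : qint (0 + l) * ecoef b.+1 a (0 + l).-1 l = 0.
  by case: l {predl} => [|l]; rewrite ?qint0 ?mul0r // ecoef_out ?mulr0 //; lia.
have tl : t ^+ (b.+1 * l) = t ^+ l * t ^+ (b * l) by rewrite mulSn exprD.
case: p => [|p]; case: q => [|q].
- rewrite predl -mulrA predr (ecoef_out _ _ _ l.+1); last lia.
  rewrite !ecoefE ecore_rec_00 tl add0n; ring.
- rewrite predl (ecoef_out _ _ _ l.+1) ?addSn /=; last lia.
  have := qrise_shift q l; rewrite addSn => shq.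
  rewrite -addSn !ecoefE ecore_rec_l0 tl add0n addSn.
  ring: shq.
- rewrite -mulrA predr (ecoef_out _ _ _ l.+1) ?addSn /=; last lia.
  have := qrise_shift p l; rewrite addSn => shp.
  rewrite -addSn !ecoefE ecore_rec_r0 tl exprD addSn; ring: shp.
- have shp := qrise_shift p l; have shq := qrise_shift q l.
  rewrite !addSn ecoefS /= -!addSn !ecoefE.
  have rec := ecore_rec p b q.
  transitivity (t ^+ (b.+1 * l) * qrise p.+1 l * qrise q.+1 l *
      (ecore p.+1 b.+1 q.+1 + t ^+ b.+1 * qint p.+1 * qint q.+1 * ecore p b.+1 q)).
    by rewrite mulrDr; congr (_ + _); ring: shp shq.
  by rewrite rec tl exprD; ring: shp shq.
Qed.

(** * The recursion on colours *)

Lemma ecoef0_min a c : ecoef 0 a c (minn a c) = qfact a * qfact c.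
Proof.
have [ac|/ltnW ca] := leqP a c.
  have := ecoefE 0 0 (c - a) a; rewrite add0n subnK // => -> /=.
  have := qfact_rise (c - a) a; rewrite subnK // => ->.
  by rewrite mul0n expr0 qfact0 qrise0l; ring.
have := ecoefE 0 (a - c) 0 c; rewrite add0n subnK // => -> /=.
have := qfact_rise (a - c) c; rewrite subnK // => ->.
by rewrite orbT mul0n expr0 qfact0 qrise0l; ring.
Qed.

Lemma ecoef0_neq a c l : l != minn a c -> ecoef 0 a c l = 0.
Proof.
rewrite /ecoef => lac; case: ifP => // /andP[la lc] /=.
by case: ifP => [|_]; [lia | rewrite mulr0].
Qed.

Section ColourRecursion.

Variables (K : comNzRingType) (phi : {rmorphism {poly int} -> K}) (x : nat -> K).

Fixpoint elsym (N k : nat) : K :=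
  if N is N'.+1 then
    elsym N' k + x N' * (if k is k'.+1 then elsym N' k' else 0)
  else (k == 0%N)%:R.

(* Peels off the largest colour, which is unused, or used by one vertex of
   A, B or C, or by one vertex of A and one of C. *)
Fixpoint colsum (N a b c : nat) : K :=
  if N is N'.+1 then
    colsum N' a b c
    + x N' * (phi (qint a) * colsum N' a.-1 b c
              + phi (t ^+ a * qint b) * colsum N' a b.-1 c
              + phi (t ^+ b * qint c) * colsum N' a b c.-1)
    + x N' ^+ 2 * phi (t ^+ b * qint a * qint c) * colsum N' a.-1 b c.-1
  else (a + b + c == 0)%N%:R.

(** Without [B] the recursion is the expansion of a product: [e_a e_c] becomes
    [(e'_a + x e'_(a-1)) (e'_c + x e'_(c-1))], and [[a]! = [a] [a-1]!] absorbs the weights. *)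
Lemma colsum_b0 N a c :
  colsum N a 0 c = phi (qfact a * qfact c) * (elsym N a * elsym N c).
Proof.
elim: N a c => [|N IHN] a c /=.
  rewrite addn0 addn_eq0 -natrM mulnb.
  by case: a c => [|a] [|c]; rewrite /= ?mulr0 // !qfact0 !mulr1 (rmorph1 phi).
rewrite !IHN !expr0 qint0 mulr0 (rmorph0 phi).
by case: a c => [|a] [|c] /=; rewrite ?qint0 ?qfactS; ring.
Qed.

Lemma sum_ecoef_shift N M b a c (g : nat -> K) : (minn a c < M)%N ->
  \sum_(l < M) phi (ecoef b a c l) *
      (g l * (if nat_of_ord l is l'.+1 then elsym N l' else 0)) =
  \sum_(l < M) phi (ecoef b a c l.+1) * (g l.+1 * elsym N l).
Proof.
case: M => // M ltM; rewrite big_ord_recl big_ord_recr /=.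
by rewrite (ecoef_out _ _ _ M.+1) // (rmorph0 phi) mul0r !mulr0 addr0 add0r.
Qed.

(** The bound [M] is arbitrary beyond the last nonzero coefficient, so that the induction hypothesis
    gives sums over the same range when [a] or [c] decreases. *)
Lemma colsum_elsym N M a b c : (minn a c < M)%N ->
  colsum N a b c =
  \sum_(l < M) phi (ecoef b a c l) * (elsym N (a + b + c - l) * elsym N l).
Proof.
elim: N M a b c => [|N IHN] M a b c ltM; (case: b => [|b];
  first (rewrite colsum_b0 addn0 (bigD1 (Ordinal ltM)) //= ecoef0_min big1 => [|l nel];
    [rewrite addr0; congr (_ * _); have [ac|ca] := leqP a c;
      [by rewrite addKn mulrC | by rewrite addnK]
    | by rewrite ecoef0_neq ?(rmorph0 phi) ?mul0r //;
         apply: contra_neq nel => e; apply: val_inj])).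
  (* Without variables only [e_0] is nonzero, and the two indices have a positive sum. *)
  rewrite /= addnS addSn eqE /=; apply/esym/big1 => l _.
  case: l => -[|l] ltl /=; last by rewrite !mulr0.
  by rewrite mul0r mulr0.
pose T l := elsym N (a + b + c - l) * elsym N l.
pose pe l := if l is l'.+1 then elsym N l' else 0.
have recA : phi (qint a) * colsum N a.-1 b.+1 c =
    \sum_(l < M) phi (qint a * ecoef b.+1 a.-1 c l) * T l.
  rewrite (IHN M) 1?mulr_sumr; last lia.
  apply: eq_bigr => l _; rewrite rmorphM mulrA; case: a @T ltM => [|a] T ltM /=.
    by rewrite qint0 (rmorph0 phi) !mul0r.
  by rewrite /T addnS addSn.
have recB : phi (t ^+ a * qint b.+1) * colsum N a b c =
    \sum_(l < M) phi (t ^+ a * qint b.+1 * ecoef b a c l) * T l.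
  by rewrite (IHN M) // mulr_sumr; apply: eq_bigr => l _; rewrite [in RHS]rmorphM mulrA.
have recC : phi (t ^+ b.+1 * qint c) * colsum N a b.+1 c.-1 =
    \sum_(l < M) phi (t ^+ b.+1 * qint c * ecoef b.+1 a c.-1 l) * T l.
  rewrite (IHN M) 1?mulr_sumr; last lia.
  apply: eq_bigr => l _; rewrite [in RHS]rmorphM mulrA.
  case: c @T ltM {recA recB} => [|c] T ltM /=.
    by rewrite qint0 mulr0 (rmorph0 phi) !mul0r.
  by rewrite /T !addnS addSn.
(* By [ecoefS] the weight turns the coefficient at [l] for [a - 1], [c - 1] into the one at [l + 1]
   for [a], [c]; shifting the index back produces [e_(l-1)]. *)
have recAC : phi (t ^+ b.+1 * qint a * qint c) * colsum N a.-1 b.+1 c.-1 =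
    \sum_(l < M) phi (ecoef b.+1 a c l) * (elsym N (a + b + c - l) * pe l).
  rewrite [RHS](sum_ecoef_shift N M b.+1 a c (fun l => elsym N (a + b + c - l))) //.
  rewrite (IHN M) 1?mulr_sumr; last lia.
  apply: eq_bigr => l _; rewrite mulrA -rmorphM.
  case: a @T ltM {recA recB recC} => [|a] T ltM /=.
    by rewrite (ecoef_out _ _ _ l.+1) ?min0n // qint0 mulr0 !mul0r (rmorph0 phi) !mul0r.
  case: c @T ltM => [|c] T ltM /=.
    by rewrite (ecoef_out _ _ _ l.+1) ?minn0 // qint0 mulr0 !mul0r (rmorph0 phi) !mul0r.
  by rewrite ecoefS !addnS !addSn subSS.
rewrite /= recA recB recC -mulrA recAC (IHN M) //.
(* The right-hand side is expanded by powers of [x N]. In the linear part, the terms that lower the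
   index [l] are shifted by one, which gives the sum of two neighbouring coefficients in
   [ecoef_rec]. *)
transitivity (\sum_(l < M) (phi (ecoef b.+1 a c l) *
   (elsym N (a + b.+1 + c - l) * elsym N l)
   + x N * (phi (ecoef b.+1 a c l) * T l)
   + x N * (phi (ecoef b.+1 a c l) * (elsym N (a + b.+1 + c - l) * pe l))
   + x N ^+ 2 * (phi (ecoef b.+1 a c l) * (elsym N (a + b + c - l) * pe l)))).
  rewrite !big_split /= -!mulr_sumr; congr (_ + _); rewrite -addrA; congr (_ + _).
  rewrite -mulrDr.
  rewrite [X in _ = _ * (_ + X)](sum_ecoef_shift N M b.+1 a c
    (fun l => elsym N (a + b.+1 + c - l))) //.
  rewrite -!big_split /=; congr (_ * _).
  apply: eq_bigr => l _; rewrite !addnS !addSn subSS -!mulrDl -!rmorphD.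
  by rewrite ecoef_rec; congr (phi _ * _); ring.
apply: eq_bigr => l _; case: (ltnP (minn a c) l) => [lt|le].
  by rewrite ecoef_out // (rmorph0 phi); ring.
rewrite /T -/(pe l); have -> : (a + b.+1 + c - l = (a + b + c - l).+1)%N by lia.
by rewrite /=; ring.
Qed.

End ColourRecursion.

(** Both sides are the coefficient of degree [k] in the product of the [1 + x_i X]: one expands it
    over subsets, the other factor by factor. *)
Lemma elsym_sets (K : comNzRingType) (x : nat -> K) N k :
  \sum_(h : {set 'I_N} | #|h| == k) \prod_(i in h) x i = elsym K x N k.
Proof.
pose G M : {poly K} := \prod_(i < M) ((x i)%:P * 'X + 1).
have elG M j : (G M)`_j = elsym K x M j.
  elim: M j => [|M IHM] j; first by rewrite /G big_ord0 coef1.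
  rewrite /G big_ord_recr /= -/(G M) mulrDr mulr1 coefD IHM addrC; congr (_ + _).
  by rewrite mulrA coefMX; case: j => [|j] /=; rewrite ?mulr0 // mulrC coefCM IHM.
rewrite -elG /G bigA_distr coef_sum big_mkcond /=; apply: eq_bigr => h _.
have -> : \prod_(i < N) (if i \in h then (x i)%:P * 'X else 1) =
    (\prod_(i in h) x i)%:P * 'X^#|h| :> {poly K}.
  rewrite -big_mkcond /= big_split /= prodr_const; congr (_ * _).
  by rewrite rmorph_prod.
by rewrite coefCM coefXn eq_sym; case: eqP => _; rewrite ?mulr1 ?mulr0.
Qed.

(** * Palindromic unimodal polynomials *)

Definition unimodal2 (D : nat) (p : {poly int}) : Prop :=
  [/\ nonneg_coefs p, palindromic2 D p & incr_to_center2 D p].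

Lemma unimodal2_1 : unimodal2 0 1.
Proof.
split=> [i|i|i //]; first by rewrite coef1; case: eqP.
by rewrite coef1; case: i => [|i]; rewrite ?subnn ?coef1.
Qed.

(** If [j] lies past the centre, palindromicity replaces it by [D - j], which is still at least
    [i]. *)
Lemma incr_to_center2_le D p i j : unimodal2 D p ->
  (i <= j)%N -> (i + j <= D)%N -> p`_i <= p`_j.
Proof.
case=> _ pal inc.
have le_half k l : (k <= l)%N -> (2 * l <= D.+1)%N -> p`_k <= p`_l.
  elim: l => [|l IHl]; first by rewrite leqn0 => /eqP->.
  rewrite leq_eqVlt => /predU1P[->//|kl] lD.
  by apply: le_trans (IHl kl _) (inc l _); lia.
move=> ij ijD; have [jD|jD] := leqP (2 * j) D; first by apply: le_half; lia.
have := pal j; rewrite ifT => [->|]; last lia.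
by apply: le_half; lia.
Qed.

Lemma coefM_qint p m i : (p * qint m)`_i = \sum_(k < m | (k <= i)%N) p`_(i - k).
Proof.
rewrite /qint mulr_sumr coef_sum [RHS]big_mkcond; apply: eq_bigr => k _.
by rewrite coefMXn ltnNge; case: leqP.
Qed.

Lemma unimodal2M_qint D p m :
  unimodal2 D p -> unimodal2 (D + m) (p * qint m.+1).
Proof.
move=> Up; have [pos pal inc] := Up.
have pD i : (D < i)%N -> p`_i = 0 by move=> h; rewrite pal ifF //; lia.
split=> [i|i|i lti].
- by rewrite coefM_qint; apply: sumr_ge0.
- case: leqP => iD; last first.
    rewrite coefM_qint big1 // => k _; apply: pD; have := ltn_ord k; lia.
  rewrite !coefM_qint [RHS](reindex_inj rev_ord_inj) /= big_mkcond [RHS]big_mkcond.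
  apply: eq_bigr => k _; have ltk := ltn_ord k; rewrite subSS.
  case: (leqP k i) => ki; case: leqP => kj.
  - case: (leqP (i - k) D) => h.
      by rewrite pal h; congr (p`_ _); lia.
    rewrite pD //; lia.
  - by rewrite pD //; lia.
  - by rewrite pD //; lia.
  - by [].
(* The coefficients are sums over a sliding window of length [m + 1]; one step adds [p_(i+1)] and
   drops [p_(i-m)], which is no nearer to the centre because [2i + 1 - m <= D]. *)
- have -> : (p * qint m.+1)`_i.+1 =
      (p * qint m.+1)`_i + p`_i.+1 - (if (m <= i)%N then p`_(i - m) else 0).
    rewrite !coefM_qint big_mkcond big_ord_recl /= subn0.
    rewrite [in RHS]big_mkcond big_ord_recr /=.
    rewrite (eq_bigr (fun k : 'I_m => if (k <= i)%N then p`_(i - k) else 0)); last first.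
      by move=> k _; rewrite /= /bump /= !add1n ltnS subSS.
    by ring.
  rewrite -addrA lerDl subr_ge0.
  case: ifP => mi; last exact: pos.
  by apply: (incr_to_center2_le _ _ _ _ Up); lia.
Qed.

Lemma unimodal2Xn D p k : unimodal2 D p -> unimodal2 (D + 2 * k) ('X^k * p).
Proof.
case=> pos pal inc; split=> [i|i|i lti]; rewrite !coefXnM.
- by case: ifP.
- case: (ltnP i k) => ik; case: (leqP i) => iD //.
  + by case: ltnP => jk //; rewrite pal ifF //; lia.
  + case: ltnP => jk; first by rewrite pal ifF //; lia.
    by rewrite pal ifT; [congr (p`_ _)|]; lia.
  + by rewrite pal ifF //; lia.
- case: ltnP => ik; first by case: ifP.
  by rewrite ifF ?subSn //; [apply: inc|]; lia.
Qed.

(** The factor [[a + i + 1]] raises [D] by [a + i]; the increment is the sum of these over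
    [i < l]. *)
Lemma unimodal2_qrise D p a l : unimodal2 D p ->
  unimodal2 (D + l * a + 'C(l, 2)) (p * qrise a l).
Proof.
move=> Up; elim: l => [|l IHl]; first by rewrite qrise0 mulr1 addn0 addn0.
have := unimodal2M_qint _ _ (a + l) IHl; rewrite -mulrA -qriseS binS bin1.
by congr (unimodal2 _ _); lia.
Qed.

Lemma unimodal2_qfact D p a : unimodal2 D p -> unimodal2 (D + 'C(a, 2)) (p * qfact a).
Proof.
move/(unimodal2_qrise _ _ 0 a); rewrite muln0 addn0.
by rewrite qrise0l.
Qed.

Lemma binD2 m n : 'C(m + n, 2) = ('C(m, 2) + 'C(n, 2) + m * n)%N.
Proof.
elim: n => [|n IHn]; first by rewrite muln0 !addn0.
by rewrite addnS !binS !bin1 IHn; lia.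
Qed.

Lemma bin2_square l : ('C(l, 2) + 'C(l, 2) + l = l * l)%N.
Proof. by elim: l => // l IHl; rewrite binS bin1; lia. Qed.

(** [D] is the number of edges, whatever [l] is: the contributions of the factors of [ecoef] add up
    to it. For [b = 0] the index is the one with a nonzero coefficient. *)
Lemma ecoef_unimodal b a c l : (l <= a)%N -> (l <= c)%N ->
  ((b == 0%N) ==> (l == minn a c)) ->
  unimodal2 ('C(a + b + c, 2) - c * a) (ecoef b a c l).
Proof.
move=> la lc b0; rewrite -(subnK la) -(subnK lc) ecoefE.
have {b0} b0 : ((b == 0%N) ==> (a - l == 0)%N || (c - l == 0)%N) by lia.
move: (a - l)%N (c - l)%N b0 => {a c la lc} p q b0.
have U1 := unimodal2_qrise _ _ q l
  (unimodal2_qrise _ _ p l (unimodal2Xn _ _ (b * l) unimodal2_1)).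
rewrite mulr1 in U1.
case: b b0 U1 => [|b] /= b0 U1.
  rewrite b0; have := unimodal2_qfact _ _ q (unimodal2_qfact _ _ p U1).
  rewrite -mulrA; congr (unimodal2 _ _); rewrite !binD2 bin0n /=.
  have ll := bin2_square l.
  by case/orP: b0 => /eqP->; rewrite ?bin0n /=; nia.
have := unimodal2M_qint _ _ (p + q + b)
  (unimodal2_qfact _ _ (b + q) (unimodal2_qrise _ _ b p U1)).
rewrite -addnS -!mulrA; congr (unimodal2 _ _).
have ll := bin2_square l.
have subE u v w : (w + v = u -> w = u - v)%N by lia.
by apply: subE; rewrite -[b.+1]addn1 !binD2 (bin_small (_ : 1 < 2)%N) //; nia.
Qed.

(** * Partial colourings *)

Section PartialColourings.

Variables (n : nat) (adj : rel 'I_n).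
Implicit Types (V S : {set 'I_n}).

Definition stable S : bool :=
  [forall u : 'I_n, forall v : 'I_n,
    [&& (u < v)%N, adj u v & u \in S] ==> (v \notin S)].

(** The number of ascents created when [S] receives a colour above all those used on [V :\: S]. *)
Definition crossing V S : nat :=
  #|[set p : 'I_n * 'I_n |
      [&& (p.1 < p.2)%N, adj p.1 p.2, p.1 \in V :\: S & p.2 \in S]]|.

(* The value [N] of a partial colouring [k] marks the uncoloured vertices. *)
Definition coloured N (k : {ffun 'I_n -> 'I_N.+1}) : {set 'I_n} :=
  [set v | (k v < N)%N].

(** It suffices to ask that [u] be coloured: an uncoloured [v] carries the mark [N], which differs
    from every colour. *)
Definition pproper N (k : {ffun 'I_n -> 'I_N.+1}) : bool :=
  [forall u : 'I_n, forall v : 'I_n,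
    [&& (u < v)%N, adj u v & (k u < N)%N] ==> (k u != k v)].

Definition pasc N (k : {ffun 'I_n -> 'I_N.+1}) : nat :=
  #|[set p : 'I_n * 'I_n |
      [&& (p.1 < p.2)%N, adj p.1 p.2, (k p.1 < k p.2)%N & (k p.2 < N)%N]]|.

Lemma stableP S :
  reflect (forall u v : 'I_n, (u < v)%N -> adj u v -> u \in S -> v \notin S)
          (stable S).
Proof.
apply: (iffP forallP) => [H u v uv a uS | H u].
  by move/forallP/(_ v)/implyP: (H u); apply; rewrite uv a.
by apply/forallP => v; apply/implyP => /and3P[]; apply: H.
Qed.

Lemma pproperP N (k : {ffun 'I_n -> 'I_N.+1}) :
  reflect (forall u v : 'I_n, (u < v)%N -> adj u v -> (k u < N)%N ->
             (k u : nat) <> k v)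
          (pproper N k).
Proof.
apply: (iffP forallP) => [H u v uv a uN | H u].
  move/forallP/(_ v)/implyP: (H u); rewrite uv a uN => /(_ isT) ne e.
  by rewrite (ord_inj e) eqxx in ne.
apply/forallP => v; apply/implyP => /and3P[uv a uN].
by apply/eqP => e; apply: (H u v uv a uN); rewrite e.
Qed.

Variables (K : comNzRingType) (phi : {rmorphism {poly int} -> K}) (x : nat -> K).

Definition pchrom N V : K :=
  \sum_(k : {ffun 'I_n -> 'I_N.+1} | (coloured N k == V) && pproper N k)
     phi (t ^+ pasc N k) * \prod_(v in V) x (k v).

Section AddColour.

Variables (N : nat) (V S : {set 'I_n}).
Hypothesis (subSV : S \subset V) (stS : stable S).

(** [h] gives [S] the new colour [N] and moves the mark of uncoloured vertices to [N + 1]; [h']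
    merges both values back into the mark [N]. *)
Let h (j : {ffun 'I_n -> 'I_N.+1}) : {ffun 'I_n -> 'I_N.+2} :=
  [ffun v : 'I_n => if v \in S then inord N
                    else if v \in V then inord (j v) else inord N.+1].
Let h' (k : {ffun 'I_n -> 'I_N.+2}) : {ffun 'I_n -> 'I_N.+1} :=
  [ffun v : 'I_n => inord (minn (k v) N)].

Let hE j (v : 'I_n) : h j v =
  (if v \in S then N else if v \in V then j v : nat else N.+1) :> nat.
Proof.
rewrite ffunE; case: ifP => _; first by rewrite inordK.
by case: ifP => _; rewrite inordK // ltnW // ltnS.
Qed.

Let h'E k (v : 'I_n) : h' k v = minn (k v) N :> nat.
Proof. by rewrite ffunE inordK // ltnS geq_minr. Qed.

Let inSV v : v \in S -> v \in V.
Proof. by move/subsetP: subSV; apply. Qed.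

Let hK k : coloured N.+1 k = V -> [set v | k v == N :> nat] = S -> h (h' k) = k.
Proof.
move=> cV cS; apply/ffunP => v; apply: ord_inj; rewrite hE h'E -cV -cS !inE.
by move: (k v) => [y /= ylt]; case: ifP => [/eqP->//|]; case: ifP; lia.
Qed.

Let pproper_h j : coloured N j = V :\: S -> pproper N.+1 (h j) = pproper N j.
Proof.
move/setP => cj; have {}cj v : (j v < N)%N = (v \notin S) && (v \in V).
  by have := cj v; rewrite !inE.
apply/pproperP/pproperP => H u v uv a.
  rewrite cj => /andP[uS uV]; have := H u v uv a; rewrite !hE uV (negPf uS).
  have := cj u; have := cj v; rewrite uV uS /=.
  case: ifP => vS /= jv ju; first by lia.
  by case: ifP jv => vV /= jv; lia.
have := H u v uv a; rewrite !hE; have := cj u; have := cj v.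
have := stableP S stS u v uv a.
case: (u \in S) (inSV u) => [->//|_] //=.
  by move=> /(_ isT)/negPf->; case: (v \in V) => /=; lia.
by move=> _; case: (v \in S) (inSV v) => [->//|_]; case: (v \in V); case: (u \in V) => /=; lia.
Qed.

Let coloured_h j : h' (h j) = j -> coloured N.+1 (h j) = V ->
  [set v | h j v == N :> nat] = S -> coloured N j = V :\: S.
Proof.
move=> hj cV cS; apply/setP => v; rewrite -{1}hj -cV -cS !inE h'E.
by have := ltn_ord (h j v); lia.
Qed.

Let pasc_h j : coloured N j = V :\: S -> pasc N.+1 (h j) = (crossing V S + pasc N j)%N.
Proof.
move/setP => cj; have {}cj v : (j v < N)%N = (v \notin S) && (v \in V).
  by have := cj v; rewrite !inE.
(* Ascents are split by whether their larger vertex lies in [S]; those where it does are exactly the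
   crossing edges, as [N] is the top colour. *)
rewrite /pasc -(cardsID [set p : 'I_n * 'I_n | p.2 \in S]); congr (_ + _)%N.
  apply: eq_card => -[u v]; rewrite !inE /= !hE.
  case: (u < v)%N => //=; case: (adj u v) => //=.
  have := cj u; case: (v \in S) => /=; last by rewrite !andbF.
  case: (u \in S) (inSV u) => /= [|_ ju]; first by lia.
  by case: (u \in V) ju => /=; lia.
apply: eq_card => -[u v]; rewrite !inE /= !hE.
case: (u < v)%N; rewrite /= ?andbF //; case: (adj u v); rewrite /= ?andbF //.
have := cj u; have := cj v; case: (v \in S) => /=; first by lia.
by case: (u \in S) => /=; case: (v \in V) => /=; case: (u \in V) => /=; lia.
Qed.

Lemma pchrom_top_class :
  \sum_(k : {ffun 'I_n -> 'I_N.+2} |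
          (coloured N.+1 k == V) && pproper N.+1 k && ([set v | k v == N :> nat] == S))
     phi (t ^+ pasc N.+1 k) * \prod_(v in V) x (k v) =
  phi (t ^+ crossing V S) * x N ^+ #|S| * pchrom N (V :\: S).
Proof.
rewrite (reindex_onto h h') => [|k /andP[/andP[/eqP cV _] /eqP cS]]; last exact: hK.
rewrite /pchrom mulr_sumr; apply: eq_big => [j|j].
  apply/andP/andP => [[/andP[/andP[/eqP cV pr] /eqP cS] /eqP hj]|[/eqP cj pr]].
    have cj := coloured_h j hj cV cS.
    by rewrite cj eqxx -(pproper_h j cj).
  have /setP cj' := cj; have {}cj' v : (j v < N)%N = (v \notin S) && (v \in V).
    by have := cj' v; rewrite !inE.
  rewrite pproper_h // pr andbT; split; last first.
    apply/eqP/ffunP => v; apply: ord_inj; rewrite h'E hE.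
    have := cj' v; have := ltn_ord (j v).
    by case: (v \in S) => /=; [|case: (v \in V)] => /=; lia.
  apply/andP; split; apply/eqP/setP => v; rewrite inE hE; have := cj' v.
    case: (v \in S) (inSV v) => [->//|_] /=; first by rewrite ltnS leqnn.
    by case: (v \in V) => /=; lia.
  by case: (v \in S) => /=; [|case: (v \in V)] => /=; lia.
move=> /andP[/andP[/andP[/eqP cV pr] /eqP cS] /eqP hj].
have cj := coloured_h j hj cV cS.
rewrite pasc_h // exprD rmorphM (big_setID S) /=.
have -> : \prod_(i in V :&: S) x (h j i) = x N ^+ #|S|.
  rewrite (setIidPr subSV) -prodr_const; apply: eq_bigr => v vS.
  by rewrite hE vS.
rewrite (eq_bigr (fun v => x (j v))); last first.
  by move=> v; rewrite inE => /andP[/negPf vS vV]; rewrite hE vS vV.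
by ring.
Qed.

End AddColour.

(** Colourings are sorted by the class [S] of the largest colour, which properness makes stable. *)
Lemma pchrom_rec N V :
  pchrom N.+1 V =
  \sum_(S : {set 'I_n} | (S \subset V) && stable S)
     phi (t ^+ crossing V S) * x N ^+ #|S| * pchrom N (V :\: S).
Proof.
rewrite /pchrom (partition_big (fun k : {ffun 'I_n -> 'I_N.+2} => [set v | k v == N :> nat])
   (fun S => (S \subset V) && stable S)) /=.
  by apply: eq_bigr => S /andP[SV stS]; apply: pchrom_top_class.
move=> k /andP[/eqP<- /pproperP pr]; apply/andP; split.
  by apply/subsetP => v; rewrite !inE => /eqP->.
apply/stableP => u v uv a; rewrite !inE => /eqP uN.
by apply/eqP => vN; apply: (pr u v uv a); rewrite uN ?vN.
Qed.

Lemma pchrom0 V : pchrom 0 V = (V == set0)%:R.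
Proof.
rewrite /pchrom; have c0 k : coloured 0 k = set0 by apply/setP => v; rewrite !inE.
case: eqP => [->|neV]; last first.
  by rewrite big_pred0 // => k; rewrite c0; case: eqP => // e; case: neV.
have p0 (k : {ffun 'I_n -> 'I_1}) : (coloured 0 k == set0) && pproper 0 k.
  by rewrite c0 eqxx; apply/pproperP.
rewrite (eq_bigl predT) // (big_pred1 [ffun=> ord0]); last first.
  by move=> k; apply/esym/eqP/ffunP => v; rewrite ffunE [k v]ord1.
rewrite big_set0 mulr1 /pasc (_ : [set _ | _] = set0) ?cards0 ?expr0 ?rmorph1 //.
by apply/setP => p; rewrite !inE !andbF.
Qed.

End PartialColourings.

(** * Two cliques sharing a clique *)

(** The exponents are the ranks [0, ..., #|U| - 1]; the induction removes the largest element, which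
    leaves the other ranks unchanged. *)
Lemma sum_qrank n (U : {set 'I_n}) :
  \sum_(v in U) t ^+ #|[set u in U | (u < v)%N]| = qint #|U|.
Proof.
elim: {U}_.+1 {-2}U (ltnSn #|U|) => // m IHm U ltU.
have [->|[u0 u0U]] := set_0Vmem U; first by rewrite big_set0 cards0 qint0.
case: (@arg_maxnP _ u0 (mem U) (@nat_of_ord n) u0U) => v vU vmax; have {}vU : v \in U by [].
have cU : #|U| = #|U :\ v|.+1 by rewrite (cardsD1 v U) vU.
rewrite (big_setD1 v) //= cU qintS addrC; congr (_ + _ ^+ _); last first.
  apply: eq_card => u; rewrite !inE -val_eqE /=.
  by case: (boolP (u \in U)) => [/vmax|]; lia.
rewrite -IHm; last by rewrite -ltnS -cU.
apply: eq_bigr => w; rewrite !inE => /andP[_ /vmax wv].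
by congr (_ ^+ _); apply: eq_card => u; rewrite !inE -val_eqE /=; lia.
Qed.

Lemma card_pairs_snd (T : finType) (P : rel T) (S : {set T}) :
  #|[set p : T * T | P p.1 p.2 && (p.2 \in S)]| =
  (\sum_(v in S) #|[set u | P u v]|)%N.
Proof.
under eq_bigr do rewrite -sum1dep_card.
rewrite (exchange_big_dep predT) //= pair_big_dep /= -sum1dep_card.
by apply: eq_bigl => p /=; rewrite andbC.
Qed.

Lemma crossingE n (adj : rel 'I_n) (V S : {set 'I_n}) :
  crossing n adj V S =
  (\sum_(v in S) #|[set u : 'I_n | [&& (u < v)%N, adj u v & u \in V :\: S]]|)%N.
Proof.
rewrite -card_pairs_snd /crossing; apply: eq_card => p.
by rewrite !inE -!andbA.
Qed.

Section TwoCliques.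

Variables (n r s : nat) (adj : rel 'I_n).
Hypothesis sr : (s <= r)%N.
Hypothesis adjE : forall u v : 'I_n, adj u v =
  [&& u != v, ~~ ((u < s)%N && (r <= v)%N) & ~~ ((v < s)%N && (r <= u)%N)].

Let A : {set 'I_n} := [set v : 'I_n | (v < s)%N].
Let B : {set 'I_n} := [set v : 'I_n | (s <= v < r)%N].
Let C : {set 'I_n} := [set v : 'I_n | (r <= v)%N].

(** Of two vertices in a stable set the smaller lies in [A] and the larger in [C], so a third vertex
    would share one of these cliques with another. *)
Lemma stable_pairP (S : {set 'I_n}) :
  stable n adj S -> #|S| != 1%N -> S != set0 ->
  exists u v, [/\ u \in A, v \in C & S = [set u; v]].
Proof.
move=> /stableP stS S1 S0.
have stS' u v : u \in S -> v \in S -> (u < v)%N -> (u < s)%N && (r <= v)%N.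
  move=> uS vS uv; have := stS u v uv; rewrite adjE -val_eqE /= uS vS; lia.
have : (1 < #|S|)%N by move: S1 S0; rewrite -card_gt0; lia.
case/card_gt1P => u [v [uS vS uv]].
wlog ltuv : u v uS vS uv / (u < v)%N.
  move=> H; move: (uv); rewrite -val_eqE neq_ltn => /orP[|] lt.
    exact: (H u v).
  by apply: (H v u) => //; rewrite eq_sym.
have /andP[us rv] := stS' u v uS vS ltuv.
exists u, v; rewrite !inE us rv; split=> //; apply/setP => w; rewrite !inE -!val_eqE /=.
apply/idP/idP => [wS|/orP[]/eqP/val_inj-> //].
have := stS' u w uS wS; have := stS' w u wS uS; have := stS' v w vS wS; have := stS' w v wS vS.
lia.
Qed.

Lemma sum_stable (M : nmodType) (V : {set 'I_n}) (F : {set 'I_n} -> M) :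
  \sum_(S : {set 'I_n} | (S \subset V) && stable n adj S) F S =
  F set0 + \sum_(v in V) F [set v]
  + \sum_(u in V :&: A) \sum_(v in V :&: C) F [set u; v].
Proof.
have st0 : stable n adj set0 by apply/stableP => u v _ _; rewrite inE.
rewrite (bigD1 set0) ?sub0set //= -addrA; congr (_ + _).
rewrite (bigID (fun S : {set 'I_n} => #|S| == 1%N)) /=; congr (_ + _).
  rewrite -(big_imset _ (h := @set1 _)) /=; last by move=> u v _ _; apply: set1_inj.
  apply: eq_bigl => S; apply/idP/imsetP => [/andP[/andP[/andP[SV _] _]] /cards1P[v Sv]|].
    by exists v => //; move: SV; rewrite Sv sub1set.
  case=> v vV ->; rewrite sub1set vV cards1 eqxx andbT /= -card_gt0 cards1 andbT.
  apply/stableP => u w uw _; rewrite !inE => /eqP uv; rewrite -uv -val_eqE /=; lia.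
rewrite pair_big_dep /=.
rewrite (eq_bigl (fun p : 'I_n * 'I_n => p \in setX (V :&: A) (V :&: C))); last first.
  by case=> u v; rewrite in_setX.
rewrite -(big_imset _ (h := fun p : 'I_n * 'I_n => [set p.1; p.2])) /=.
  apply: eq_bigl => S; apply/idP/imsetP => [/andP[/andP[/andP[SV stS] S0] S1]|].
    have [u [v [uA vC eS]]] := stable_pairP S stS S1 S0.
    exists (u, v) => //; rewrite !inE /=; move: uA vC; rewrite !inE => -> ->.
    by move: SV; rewrite eS subUset !sub1set => /andP[-> ->].
  case=> -[u v] /=; rewrite !inE /= => /andP[/andP[uV uA] /andP[vV vC]] ->.
  have uv : u != v by rewrite -val_eqE /=; lia.
  rewrite subUset !sub1set uV vV cards2 uv /= andbT -card_gt0 cards2 uv /= andbT.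
  apply/stableP => w z wz; rewrite adjE !inE -!val_eqE /=; lia.
move=> [u v] [u' v']; rewrite !inE /=.
move=> /andP[/andP[_ uA] /andP[_ vC]] /andP[/andP[_ uA'] /andP[_ vC']].
move/setP => e; have := e u; have := e v; rewrite !inE -!val_eqE /= !eqxx orbT /=.
move=> /esym ev /esym eu; congr pair; apply: val_inj => /=; lia.
Qed.

(** The three rank lemmas give the exponents of [colsum]: the smaller neighbours of [v] left in [V]
    are the earlier vertices of its own block, together with all of [A] if [v] is in [B], and all of
    [B] if [v] is in [C]. *)
Lemma rankA (V S : {set 'I_n}) (v : 'I_n) : (v < s)%N ->
    (forall w, w \in S -> (w < s)%N -> w = v) ->
  #|[set u : 'I_n | [&& (u < v)%N, adj u v & u \in V :\: S]]| =
  #|[set u in V :&: A | (u < v)%N]|.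
Proof.
move=> vs Sv; apply: eq_card => u; rewrite !inE adjE -val_eqE /=.
have := Sv u; case: (u \in S) => /=; last by lia.
by case: (ltnP u s) => us; [move=> /(_ isT isT)->|move=> _]; lia.
Qed.

Lemma rankB (V S : {set 'I_n}) (v : 'I_n) : (s <= v < r)%N -> S = [set v] ->
  #|[set u : 'I_n | [&& (u < v)%N, adj u v & u \in V :\: S]]| =
  (#|V :&: A| + #|[set u in V :&: B | (u < v)%N]|)%N.
Proof.
move=> vB ->; rewrite -[LHS](cardsID A). congr (_ + _)%N; apply: eq_card => u;
  rewrite !inE adjE -!val_eqE /=; lia.
Qed.

Lemma rankC (V S : {set 'I_n}) (v : 'I_n) : (r <= v)%N ->
    (forall w, w \in S -> (w < s)%N || (w == v)) ->
  #|[set u : 'I_n | [&& (u < v)%N, adj u v & u \in V :\: S]]| =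
  (#|V :&: B| + #|[set u in V :&: C | (u < v)%N]|)%N.
Proof.
move=> vC Sv; rewrite -[LHS](cardsID B); congr (_ + _)%N; apply: eq_card => u;
  have := Sv u; rewrite !inE adjE -!val_eqE /=; lia.
Qed.

Variables (K : comNzRingType) (phi : {rmorphism {poly int} -> K}) (x : nat -> K).

Lemma pchrom_colsum N (V : {set 'I_n}) :
  pchrom n adj K phi x N V =
  colsum K phi x N #|V :&: A| #|V :&: B| #|V :&: C|.
Proof.
have cardI1 v (Z W : {set 'I_n}) : v \in Z -> #|(Z :\ v) :&: W| = (#|Z :&: W| - (v \in W))%N.
  by move=> vZ; rewrite setIDAC (cardsD1 v (Z :&: W)) inE vZ addKn.
have ABC (v : 'I_n) : ((v \in A) + (v \in B) + (v \in C) = 1)%N by rewrite !inE; lia.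
elim: N V => [|N IHN] V.
  rewrite pchrom0 /=; congr (_%:R); congr nat_of_bool.
  rewrite !addn_eq0 !cards_eq0; apply/eqP/andP => [->|]; first by rewrite !set0I !eqxx.
  case=> /andP[/eqP/setP VA /eqP/setP VB] /eqP/setP VC; apply/setP => v; rewrite inE.
  have := VA v; have := VB v; have := VC v; have := ABC v.
  rewrite !(inE, in_set0); lia.
rewrite pchrom_rec sum_stable /=; congr (_ + _ + _).
- rewrite crossingE big_set0 cards0 !expr0 rmorph1 !mul1r setD0; exact: IHN.
- pose G v := phi (t ^+ crossing n adj V [set v]) * x N ^+ #|[set v]| *
      pchrom n adj K phi x N (V :\ v).
  have sumA : \sum_(v in V :&: A) G v =
      x N * (phi (qint #|V :&: A|) * colsum K phi x N #|V :&: A|.-1 #|V :&: B| #|V :&: C|).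
    rewrite -sum_qrank rmorph_sum mulr_suml mulr_sumr; apply: eq_bigr => v.
    rewrite inE => /andP[vV vA]; rewrite /G IHN !cardI1 // vA.
    have := ABC v; rewrite vA => vBC; have [-> ->] : v \in B = false /\ v \in C = false by lia.
    rewrite !subn0 subn1 crossingE big_set1 rankA ?cards1; first by ring.
      by move: vA; rewrite inE.
    by move=> w; rewrite inE => /eqP.
  have sumB : \sum_(v in V :&: B) G v =
      x N * (phi (t ^+ #|V :&: A| * qint #|V :&: B|) *
             colsum K phi x N #|V :&: A| #|V :&: B|.-1 #|V :&: C|).
    rewrite -sum_qrank mulr_sumr rmorph_sum mulr_suml mulr_sumr; apply: eq_bigr => v.
    rewrite inE => /andP[vV vB]; rewrite /G IHN !cardI1 // vB.
    have := ABC v; rewrite vB => vAC; have [-> ->] : v \in A = false /\ v \in C = false by lia.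
    rewrite !subn0 subn1 crossingE big_set1 rankB ?cards1 // ?exprD; first by ring.
    by move: vB; rewrite inE.
  have sumC : \sum_(v in V :&: C) G v =
      x N * (phi (t ^+ #|V :&: B| * qint #|V :&: C|) *
             colsum K phi x N #|V :&: A| #|V :&: B| #|V :&: C|.-1).
    rewrite -sum_qrank mulr_sumr rmorph_sum mulr_suml mulr_sumr; apply: eq_bigr => v.
    rewrite inE => /andP[vV vC]; rewrite /G IHN !cardI1 // vC.
    have := ABC v; rewrite vC => vAB; have [-> ->] : v \in A = false /\ v \in B = false by lia.
    rewrite !subn0 subn1 crossingE big_set1 rankC ?cards1 // ?exprD; first by ring.
      by move: vC; rewrite inE.
    by move=> w; rewrite inE => ->; rewrite orbT.
  rewrite !mulrDr -sumA -sumB -sumC (big_setID A) -addrA; congr (_ + _).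
  rewrite (big_setID B); congr (_ + _); apply: eq_bigl => v; have := ABC v;
    by rewrite !(in_setI, in_setD); case: (v \in A); case: (v \in B);
      case: (v \in C); rewrite //= ?andbT ?andbF.
(* For a class [{u, v}] the exponent is the rank of [u] in [A], plus the size of [B], plus the rank
   of [v] in [C], so the double sum factors into [[a] [c]]. *)
- pose Y := x N ^+ 2 * phi (t ^+ #|V :&: B|) *
    colsum K phi x N #|V :&: A|.-1 #|V :&: B| #|V :&: C|.-1.
  transitivity (phi (qint #|V :&: A|) * (phi (qint #|V :&: C|) * Y)); last first.
    by rewrite /Y; ring.
  rewrite -[in RHS]sum_qrank rmorph_sum mulr_suml; apply: eq_bigr => u.
  rewrite inE => /andP[uV uA].
  rewrite -sum_qrank rmorph_sum mulr_suml mulr_sumr; apply: eq_bigr => v.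
  rewrite inE => /andP[vV vC]; rewrite {}/Y.
  have := ABC u; rewrite uA => uBC; have [uB uC] : u \in B = false /\ u \in C = false by lia.
  have := ABC v; rewrite vC => vAB; have [vA vB] : v \in A = false /\ v \in B = false by lia.
  have uv : u != v by apply: contraTneq uA => ->; rewrite vA.
  have us : (u < s)%N by move: uA; rewrite inE.
  have rv : (r <= v)%N by move: vC; rewrite inE.
  have cardI2 W : #|(V :\: [set u; v]) :&: W| = (#|V :&: W| - (u \in W) - (v \in W))%N.
    by rewrite -setDDl !cardI1 // !inE eq_sym uv.
  rewrite IHN !cardI2 uA uB uC vA vB vC !subn0 !subn1 crossingE big_setU1 ?inE //= big_set1.
  rewrite rankA // ?rankC // ?cards2 ?uv ?exprD ?rmorphM; first by ring.
  - by move=> w; rewrite !inE => /orP[] /eqP->; rewrite ?us ?eqxx ?orbT.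
  - move=> w; rewrite !inE => /orP[] /eqP-> // vs; lia.
Qed.

End TwoCliques.

(** * The expansion of the chromatic quasisymmetric function *)

Definition mvar (N i : nat) : {mpoly {poly int}[N]} :=
  if insub i is Some j then 'X_j else 0.

Lemma mvar_ord N (i : 'I_N) : mvar N i = 'X_i.
Proof. by rewrite /mvar valK. Qed.

Lemma mesym_elsym N k : mesym N {poly int} k = elsym _ (mvar N) N k.
Proof.
rewrite -elsym_sets; apply: eq_bigr => h _; apply: eq_bigr => i _.
by rewrite mvar_ord.
Qed.

Lemma chromQ_pchrom n (adj : rel 'I_n) N : (0 < n)%N ->
  chromQ adj N = pchrom n adj _ (@mpolyC N {poly int}) (mvar N) N setT.
Proof.
(* With a vertex but no colour both sides are 0; for [N.+1] colours the mark never occurs, since all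
   vertices are coloured. *)
case: n adj => // n adj _; case: N => [|N].
  rewrite pchrom0 /chromQ big1 => [|k]; last by case: (k ord0).
  by case: eqP => // /setP/(_ ord0); rewrite !inE.
pose h (j : {ffun 'I_n.+1 -> 'I_N.+1}) : {ffun 'I_n.+1 -> 'I_N.+2} :=
  [ffun v => widen_ord (leqnSn _) (j v)].
pose h' (k : {ffun 'I_n.+1 -> 'I_N.+2}) : {ffun 'I_n.+1 -> 'I_N.+1} :=
  [ffun v => inord (k v)].
have hE j v : h j v = j v :> nat by rewrite ffunE.
rewrite /pchrom (reindex_onto h h') => [|k /andP[/eqP/setP cT _]]; last first.
  apply/ffunP => v; apply: ord_inj; rewrite hE ffunE inordK //.
  by have := cT v; rewrite !inE.
apply: eq_big => [j|j _].
  have -> : h' (h j) == j by apply/eqP/ffunP => v; apply: ord_inj; rewrite ffunE inordK hE.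
  have -> : coloured n.+1 N.+1 (h j) == setT.
    by apply/eqP/setP => v; rewrite !inE hE ltn_ord.
  rewrite andbT /= /proper_col /pproper.
  apply: eq_forallb => u; apply: eq_forallb => v.
  by rewrite hE ltn_ord andbT -!val_eqE /= !hE.
rewrite mul_mpolyC; congr (_ ^+ _ *: _).
  by apply: eq_card => p; rewrite !inE !hE ltn_ord andbT.
by apply: eq_big => [v|v _]; rewrite ?inE // hE mvar_ord.
Qed.

Lemma card_ord_lt n m : (m <= n)%N -> #|[set v : 'I_n | (v < m)%N]| = m.
Proof.
move=> mn; rewrite -sum1dep_card -(big_ord_widen _ (fun _ => 1%N)) //=.
by rewrite sum1_card card_ord.
Qed.

Lemma qint_monic m : qint m.+1 \is monic.
Proof.
have -> : qint m.+1 = \poly_(i < m.+1) 1.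
  by rewrite poly_def; apply: eq_bigr => i _; rewrite scale1r.
by apply/eqP; rewrite lead_coef_poly.
Qed.

Lemma qfact_monic m : qfact m \is monic.
Proof.
elim: m => [|m IHm]; first by rewrite qfact0 monic1.
by rewrite qfactS monicMl ?IHm ?qint_monic.
Qed.

(** A product of q-factorials is monic, so the division over the integers is exact, and it remains
    to factor the denominator out of the numerator. *)
Lemma ecoef_div n r s l : (s < r)%N -> (r <= n)%N -> (l <= minn (n - r) s)%N ->
  'X^((r - s) * l) *
    ((qfact (n - r) * qfact s * qfact (r - l - 1) * qfact (n - s - l - 1)
      * qint (n - 2 * l))
     %/ (qfact (n - r - l) * qfact (s - l) * qfact (r - s - 1))) =
  ecoef (r - s) s (n - r) l.
Proof.
move=> sr rn lm; have [ls lc] : (l <= s)%N /\ (l <= n - r)%N by lia.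
have [b eb] : exists b, (r - s = b.+1)%N by exists (r - s).-1; lia.
have [p ep] : exists p, s = (p + l)%N by exists (s - l)%N; lia.
have [q eq] : exists q, (n - r = q + l)%N by exists (n - r - l)%N; lia.
rewrite eb eq [in RHS]ep ecoefE -!mulrA; congr (_ * _).
have -> : (r - l - 1 = b + p)%N by lia.
have -> : (n - s - l - 1 = b + q)%N by lia.
have -> : (n - 2 * l = p + q + b.+1)%N by lia.
rewrite ep !addnK subSS subn0 !qfact_rise.
have mon : qfact q * (qfact p * qfact b) \is monic by rewrite !monicMl ?qfact_monic.
rewrite -[RHS](Pdiv.IdomainMonic.mulpK mon); congr (_ %/ _).
by rewrite /= qfact_rise; ring.
Qed.

Section IncGraph.

Variables (n r s : nat) (m : nat -> nat).
Hypotheses (hsr : (s <= r)%N) (hrn : (r <= n.-1)%N) (hr : (0 < r)%N).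
Hypothesis hm1 : forall i, (1 <= i <= s)%N -> m i = r.
Hypothesis hm2 : forall i, (s < i <= n.-1)%N -> m i = n.

(** Vertices count from 0, so a label at most [s] means [u < s] and a label above [r] means
    [r <= v]. Labels beyond [s] have nothing above them, as [m] is [n] there. *)
Lemma inc_adjE (u v : 'I_n) : inc_adj m u v =
  [&& u != v, ~~ ((u < s)%N && (r <= v)%N) & ~~ ((v < s)%N && (r <= u)%N)].
Proof.
have lt (w z : 'I_n) : nuio_lt n m w.+1 z.+1 = (w < s)%N && (r <= z)%N.
  rewrite /nuio_lt ltn_ord andbT; case: (ltnP w s) => ws.
    by rewrite hm1 //= ltnS; lia.
  case: (ltnP w.+1 n) => //= wn; rewrite hm2; last lia.
  by have := ltn_ord z; lia.
by rewrite /inc_adj !lt.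
Qed.

Lemma chromQ_expansion N :
  chromQ (@inc_adj n m) N =
  \sum_(l < (minn s (n - r)).+1)
     ecoef (r - s) s (n - r) l *:
       (mesym N {poly int} (n - l) * mesym N {poly int} l).
Proof.
rewrite chromQ_pchrom; last lia.
rewrite (pchrom_colsum n r s _ hsr inc_adjE) !setTI.
have cA : #|[set v : 'I_n | (v < s)%N]| = s by rewrite card_ord_lt //; lia.
have cAB : #|[set v : 'I_n | (v < r)%N]| = r by rewrite card_ord_lt //; lia.
have -> : #|[set v : 'I_n | (s <= v < r)%N]| = (r - s)%N.
  have := cardsID [set v : 'I_n | (v < s)%N] [set v : 'I_n | (v < r)%N].
  rewrite cAB (_ : _ :&: _ = [set v : 'I_n | (v < s)%N]); last first.
    by apply/setP => v; rewrite !inE; lia.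
  rewrite (_ : _ :\: _ = [set v : 'I_n | (s <= v < r)%N]); first by rewrite cA; lia.
  by apply/setP => v; rewrite !inE -leqNgt.
have -> : #|[set v : 'I_n | (r <= v)%N]| = (n - r)%N.
  have := cardsC [set v : 'I_n | (v < r)%N]; rewrite cAB card_ord.
  rewrite (_ : ~: _ = [set v : 'I_n | (r <= v)%N]); first lia.
  by apply/setP => v; rewrite !inE -leqNgt.
rewrite cA (colsum_elsym _ _ _ _ (minn s (n - r)).+1) //.
apply: eq_bigr => l _; rewrite !mesym_elsym -mul_mpolyC; congr (_ * (_ * _)).
by congr (elsym _ _ _ _); lia.
Qed.

End IncGraph.

(** The part 0 is dropped because [is_partition] asks for positive parts; the product is unchanged
    since [e_0 = 1]. *)
Definition two_part (n l : nat) : seq nat :=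
  if l == 0%N then [:: n] else [:: (n - l)%N; l].

Theorem theorem4p2 (n r s : nat) (m : nat -> nat)
    (hs : (0 < s)%N) (hr : (0 < r)%N) (hsr : (s <= r)%N) (hrn : (r <= n.-1)%N)
    (hm1 : forall i, (1 <= i <= s)%N -> m i = r)
    (hm2 : forall i, (s < i <= n.-1)%N -> m i = n) :
  ((s < r)%N ->
   forall N,
     chromQ (@inc_adj n m) N =
     \sum_(0 <= l < (minn (n - r) s).+1)
        (('X^((r - s) * l) *
          ((qfact (n - r) * qfact s * qfact (r - l - 1) * qfact (n - s - l - 1)
             * qint (n - 2 * l))
          %/ (qfact (n - r - l) * qfact (s - l) * qfact (r - s - 1))))
         *: e_part N [:: n - l; l]%N))
  /\ e_positive n (chromQ (@inc_adj n m))
  /\ e_unimodal2 n (chromQ (@inc_adj n m)) ('C(n, 2) - (n - r) * s).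
Proof.
have expn := chromQ_expansion n r s m hsr hrn hr hm1 hm2.
split=> [sr N|].
  rewrite expn minnC big_mkord; apply: eq_bigr => l _.
  rewrite ecoef_div //; [|lia|by rewrite -ltnS ltn_ord].
  by rewrite /e_part !big_cons big_nil mulr1.
suff uni : e_unimodal2 n (chromQ (@inc_adj n m)) ('C(n, 2) - (n - r) * s).
  by split=> //; case: uni => L [c [ex U]]; exists L, c; split=> // la /U[].
(* For [r = s] every coefficient except the last one vanishes, and only that index is kept. *)
pose P l := ((r - s == 0) ==> (l == minn s (n - r)))%N.
exists [seq two_part n l | l <- iota 0 (minn s (n - r)).+1 & P l].
(* The index [l] is read off as the second part, with default 0 for the one-part partition. *)
exists (fun la => ecoef (r - s) s (n - r) (nth 0%N la 1)).
have part1 l : nth 0%N (two_part n l) 1 = l by rewrite /two_part; case: eqP.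
split; last first.
  move=> la /mapP[l]; rewrite mem_filter mem_iota => /andP[Pl lm] ->.
  have -> : 'C(n, 2) = 'C(s + (r - s) + (n - r), 2) by congr 'C(_, _); lia.
  by rewrite part1; apply: ecoef_unimodal => //; lia.
split.
- rewrite map_inj_uniq ?filter_uniq ?iota_uniq //.
  by move=> k l e; rewrite -(part1 k) e part1.
- apply/allP => la /mapP[l]; rewrite mem_filter mem_iota => /andP[Pl lm] ->.
  (* The parts are in order because [l <= s <= r] and [l <= n - r] give [2l <= n]. *)
  rewrite /is_partition /two_part; case: eqP => [_|l0] /=; lia.
move=> N; rewrite expn big_map big_filter.
rewrite -(big_mkord predT (fun l => ecoef (r - s) s (n - r) l *:
  (mesym N {poly int} (n - l) * mesym N {poly int} l))) /index_iota subn0.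
rewrite (bigID P) /= [X in _ + X]big1 ?addr0 => [|l nP]; last first.
  suff -> : ecoef (r - s) s (n - r) l = 0 by rewrite scale0r.
  by move: nP; rewrite /P negb_imply => /andP[/eqP-> ?]; rewrite ecoef0_neq.
apply: eq_bigr => l _; rewrite part1 /e_part /two_part; congr (_ *: _).
case: eqP => [->|_]; rewrite !big_cons big_nil ?mulr1 // subn0 mesym0E mulr1 //.
Qed.
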